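(* Let $t\ge 2$ and $m\ge 1$ be integers. Let $S^+_{m,t}$ be the set of $(t,mt+1)$-core partitions with distinct parts, and let $\mathcal{C}^+_{m,t}$ be the set of all sequences $(x_1,\ldots,x_{t-1})\in\mathbb{N}^{t-1}$ with $0\le x_i\le m$ for $1\le i\le t-1$ and $x_ix_{i+1}=0$ for $1\le i\le t-2$. Then the map $\psi(\lambda)=(n_1(\lambda),n_2(\lambda),\ldots,n_{t-1}(\lambda))$ is a bijection from $S^+_{m,t}$ to $\mathcal{C}^+_{m,t}$.
   Context: A partition is a finite weakly decreasing sequence $\lambda=(\lambda_1,\ldots,\lambda_\ell)$ of positive integers; it has distinct parts if $\lambda_1>\cdots>\lambda_\ell$. The hook length of box $(i,j)$ of the Young diagram is the number of boxes directly to its right, directly below it, plus the box itself; $\lambda$ is an $s$-core if no hook length is divisible by $s$, and a $(t_1,t_2)$-core if it is both a $t_1$-core and a $t_2$-core. The $\beta$-set of $\lambda$ is $\beta(\lambda)=\{\lambda_i+\ell-i:1\le i\le \ell\}$. For $1\le i\le t-1$, $n_i(\lambda)$ denotes the number of integers $x\in\beta(\lambda)$ with $x\equiv i\pmod t$. $\mathbb{N}$ includes $0$. *)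

(* Defs.v *)
From mathcomp Require Import all_boot.
From mathcomp Require Import classical_sets functions.

Set Implicit Arguments.
Unset Strict Implicit.
Unset Printing Implicit Defensive.

Local Open Scope classical_set_scope.

(* Rows, columns and parts are numbered from 0: the part lambda_i of the
   mathematical convention is nth 0 la i.-1, and the box (i, j) is
   (i.-1, j.-1). *)

Definition is_partition (la : seq nat) : bool :=
  sorted geq la && all (fun p => 0 < p) la.

Definition distinct_parts (la : seq nat) : bool := sorted gtn la.

Definition in_diagram (la : seq nat) (i j : nat) : bool :=
  (i < size la) && (j < nth 0 la i).

Definition arm (la : seq nat) (i j : nat) : nat := nth 0 la i - j.+1.

(* The boxes below (i, j) lie in the later rows having more than j boxes. *)
Definition leg (la : seq nat) (i j : nat) : nat :=
  count (fun p => j < p) (drop i.+1 la).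

Definition hook_length (la : seq nat) (i j : nat) : nat :=
  arm la i j + leg la i j + 1.

Definition is_core (s : nat) (la : seq nat) : Prop :=
  forall i j, in_diagram la i j -> ~~ (s %| hook_length la i j).

(* Listed in the order of the parts; beta_set_uniq below shows that the list
   has no repetition when la is a partition, so counting in the list is
   counting in the set. *)
Definition beta_set (la : seq nat) : seq nat :=
  [seq nth 0 la k + (size la - k.+1) | k <- iota 0 (size la)].

Lemma beta_set_uniq (la : seq nat) : is_partition la -> uniq (beta_set la).
Proof.
case/andP=> sla _; apply: (@sorted_uniq _ gtn).
- by move=> y x z /= yx zy; apply: ltn_trans yx.
- by move=> x; apply: ltnn.
apply/(sortedP 0) => i; rewrite size_map size_iota => lti.
rewrite !(nth_map 0) ?size_iota ?(ltnW lti) // !nth_iota ?(ltnW lti) // !add0n.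
have /= h := (sortedP 0 sla) i lti.
by rewrite /= -addnS leq_add // ltn_sub2l.
Qed.

Definition n_res (t i : nat) (la : seq nat) : nat :=
  count (fun x => x == i %[mod t]) (beta_set la).

Definition Splus (m t : nat) : set (seq nat) :=
  [set la | [/\ is_partition la, distinct_parts la,
                is_core t la & is_core (m * t + 1) la]].

(* The entry x_i (1 <= i <= t - 1) of the sequence x is nth 0 x i.-1. *)
Definition Cplus (m t : nat) : set (t.-1.-tuple nat) :=
  [set x : t.-1.-tuple nat |
     (forall i, i < t.-1 -> nth 0 x i <= m) /\
     (forall i, i.+1 < t.-1 -> nth 0 x i * nth 0 x i.+1 = 0)].
Arguments Cplus : clear implicits.

Definition psi (t : nat) (la : seq nat) : t.-1.-tuple nat :=
  [tuple n_res t i.+1 la | i < t.-1].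

(* Main.v *)
Require Import Defs.
From mathcomp Require Import all_boot zify.
From mathcomp Require Import classical_sets functions.

(** The hook lengths in the row of a beta-number [b] are the differences [b - c]
    with [c < b] outside the beta-set [B], so a partition is an [s]-core exactly
    when [B] is closed under subtracting [s].  Hence a [t]-core is described by
    the numbers [n_i] through [i + k t \in B <-> k < n_i], with [n_0 = 0] because
    [0] is not a beta-number.  The parts are distinct iff [B] contains no two
    consecutive integers, that is, iff [n_i n_(i+1) = 0].  Finally, for
    [i + m t \in B] the number [i + m t - (m t + 1) = i - 1] would be adjacent to
    [i \in B] (or be [0]), so the [(m t + 1)]-core condition says [n_i <= m]. *)

Set Implicit Arguments.
Unset Strict Implicit.
Unset Printing Implicit Defensive.

Definition sub_closed (s : nat) (B : seq nat) : Prop :=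
  forall b, b \in B -> s <= b -> b - s \in B.

Lemma sub_closed_muln s B k b :
  sub_closed s B -> b \in B -> k * s <= b -> b - k * s \in B.
Proof.
move=> hB bB; elim: k => [|k IH] hk; first by rewrite mul0n subn0.
have -> : b - k.+1 * s = b - k * s - s by lia.
by apply: hB; [apply: IH; lia | lia].
Qed.

(** * Beta-sets and hook lengths *)

Lemma beta_set_cons p la : beta_set (p :: la) = p + size la :: beta_set la.
Proof.
rewrite /beta_set /= subSS subn0; congr (_ :: _).
rewrite -[1]/(1 + 0) iotaDl -map_comp; apply: eq_map => k /=.
by rewrite add1n subSS.
Qed.

Lemma size_beta_set la : size (beta_set la) = size la.
Proof. by rewrite size_map size_iota. Qed.

Lemma beta_set_inj : injective beta_set.
Proof.
elim=> [|p la IH] [|q mu] //; rewrite !beta_set_cons // => -[E1 E2].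
have E3 := IH _ E2; subst mu; congr (_ :: _); lia.
Qed.

Lemma is_partition_cons p la :
  is_partition (p :: la) = [&& 0 < p, all (geq p) la & is_partition la].
Proof.
rewrite /is_partition /= path_sortedE; last by move=> a b c /=; lia.
by case: (0 < p); rewrite /= ?andbF //= ?andbA.
Qed.

Lemma beta_set_lt p la x :
  all (geq p) la -> x \in beta_set la -> x < p + size la.
Proof.
elim: la x => [|q la IH] x //= /andP[qp hla].
by rewrite beta_set_cons inE => /orP[/eqP->|/(IH _ hla)]; lia.
Qed.

Lemma sorted_beta_set la : is_partition la -> sorted gtn (beta_set la).
Proof.
elim: la => [|p la IH] //; rewrite is_partition_cons => /and3P[p0 hp hla].
rewrite beta_set_cons /= path_sortedE; last by move=> a b c /=; lia.
rewrite IH // andbT; apply/allP => x /(beta_set_lt hp) /=; lia.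
Qed.

Lemma mem0_beta_set la : is_partition la -> 0 \notin beta_set la.
Proof.
elim: la => [|p la IH] //; rewrite is_partition_cons => /and3P[p0 hp hla].
by rewrite beta_set_cons inE negb_or IH // andbT; lia.
Qed.

(** The horizontal boundary step of column [j]: for a partition, this is the [j]-th number, counted
    from 0, outside the beta-set. *)
Definition gap (la : seq nat) (j : nat) : nat := j + count (geq j) la.

Lemma gap_large la j : all (geq j) la -> gap la j = j + size la.
Proof. by rewrite /gap all_count => /eqP ->. Qed.

Lemma all_geqW p j la : p <= j -> all (geq p) la -> all (geq j) la.
Proof. by move=> pj; apply: sub_all => x /=; lia. Qed.

Lemma gap_notin_beta_set la j : is_partition la -> gap la j \notin beta_set la.
Proof.
elim: la j => [|p la IH] j //; rewrite is_partition_cons => /and3P[p0 hp hla].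
rewrite beta_set_cons inE negb_or /gap /=.
case: (leqP p j) => pj.
  have E := gap_large (all_geqW pj hp).
  have E' := gap_large (all_geqW (leqW pj) hp).
  have := IH j.+1 hla; rewrite E'; rewrite /gap in E.
  have -> : j + (1 + count (geq j) la) = j.+1 + size la by lia.
  by move->; lia.
have := IH j hla; rewrite /gap => ->; rewrite andbT.
have := count_size (geq j) la; lia.
Qed.

Lemma notin_beta_set_gap la c :
  is_partition la -> c \notin beta_set la -> exists j, c = gap la j.
Proof.
elim: la c => [|p la IH] c; first by exists c; rewrite /gap addn0.
rewrite is_partition_cons beta_set_cons inE negb_or.
move=> /and3P[p0 hp hla] /andP[cp /(IH _ hla)[j E]].
case: (ltnP j p) => pj; first by exists j; rewrite E /gap /= leqNgt pj.
(* Here [c = j + size la] lies above the new beta-number [p + size la], so its index among the gaps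
   drops by one. *)
have E' := gap_large (all_geqW pj hp).
have ltpj : p <= j.-1 by lia.
have E'' := gap_large (all_geqW ltpj hp).
exists j.-1; rewrite /gap /= in E'' *; lia.
Qed.

(** The leg counts the later parts exceeding [j] and [gap] counts the others, so the two counts add
    up to [size la]. *)
Lemma hook_length_cons0 p la j : j < p ->
  hook_length (p :: la) 0 j = p + size la - gap la j.
Proof.
move=> jp; rewrite /hook_length /arm /leg /gap /= drop0.
rewrite -(count_predC (geq j) la).
have -> : count (fun q => j < q) la = count (predC (geq j)) la.
  by apply: eq_count => x /=; lia.
lia.
Qed.

Lemma is_core_cons s p la :
  is_core s (p :: la) <->
  (forall j, j < p -> ~~ (s %| p + size la - gap la j)) /\ is_core s la.
Proof.
split=> [h|[h0 h] [|i] j].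
- split=> [j jp|i j hij]; last exact: (h i.+1 j).
  by rewrite -hook_length_cons0 //; apply: h.
- by rewrite /in_diagram /= => jp; rewrite hook_length_cons0 //; apply: h0.
- exact: (h i j).
Qed.

Lemma is_core_sub_closed s la :
  is_partition la -> (is_core s la <-> sub_closed s (beta_set la)).
Proof.
elim: la => [|p la IH]; first by split=> // _ i j; rewrite /in_diagram.
rewrite is_partition_cons is_core_cons => /and3P[p0 hp hla].
rewrite IH // beta_set_cons; split=> [[h0 h] b|h].
  rewrite inE => /orP[/eqP->|bB] sb; last by rewrite inE h ?orbT.
  (* Closure is trivial for [s = 0]. Otherwise a missing difference is a gap below the head, in a
     column [j < p], whose hook has length exactly [s]. *)
  rewrite inE; case: (s =P 0) => [->|s0]; first by rewrite subn0 eqxx.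
  apply/orP; right; apply/negPn/negP => /(notin_beta_set_gap hla)[j E].
  have jp : j < p.
    rewrite ltnNge; apply/negP => pj.
    have := gap_large (all_geqW pj hp); lia.
  have := h0 j jp; rewrite -E subKn // dvdnn //.
split=> [j jp|b bB sb]; last first.
  have /h := sb; rewrite !inE bB orbT => /(_ isT) /orP[/eqP E|//].
  by have := beta_set_lt hp bB; lia.
(* If the hook length is [k * s], then subtracting [s] from the head [k] times reaches a gap,
   against closure. *)
apply/negP => /dvdnP[k E].
have lt_gap : gap la j < p + size la.
  by have := count_size (geq j) la; rewrite /gap; lia.
have := sub_closed_muln (k := k) h (mem_head _ _); rewrite -E.
rewrite subKn ?(ltnW lt_gap) // leq_subr inE => /(_ isT) /orP[|]; first by lia.
by apply/negP; apply: gap_notin_beta_set.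
Qed.

(** Neighbouring beta-numbers differ by one more than the corresponding parts do, so they are
    consecutive exactly when these parts coincide. *)
Lemma distinct_parts_beta_set la : is_partition la ->
  (distinct_parts la <-> forall x, x \in beta_set la -> x.+1 \notin beta_set la).
Proof.
have tr : transitive gtn by move=> a b c /=; lia.
elim: la => [|p la IH] //; rewrite is_partition_cons => /and3P[p0 hp hla].
rewrite /distinct_parts /= path_sortedE // beta_set_cons; split.
  move=> /andP[hlt /(IH hla) h] x.
  have hlt1 : all (geq p.-1) la by apply: sub_all hlt => y /=; lia.
  rewrite !inE negb_or => /orP[/eqP->|xB].
    rewrite neq_ltn ltnSn orbT /=; apply/negP => /(beta_set_lt hp); lia.
  rewrite h // andbT; have := beta_set_lt hlt1 xB; lia.
move=> h; have /(IH hla) hs : forall x, x \in beta_set la -> x.+1 \notin beta_set la.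
  move=> x xB; have := h x; rewrite !inE xB orbT negb_or => /(_ isT).
  by case/andP.
rewrite -/(distinct_parts la) hs andbT.
case: la hp hla hs h {IH} => [|q la] //= /andP[qp hp] hla hs h.
have ltqp : q < p.
  have := h (q + size la); rewrite beta_set_cons !inE eqxx orbT => /(_ isT).
  by rewrite negb_or => /andP[]; lia.
rewrite ltqp /=; move: hla; rewrite is_partition_cons => /and3P[_ + _].
by apply: sub_all => x /=; lia.
Qed.

(** Inverse of [beta_set] on strictly decreasing lists of positive integers: each entry exceeds the
    number of entries after it, so no subtraction is truncated. *)
Fixpoint parts_of_beta (B : seq nat) : seq nat :=
  if B is b :: B' then b - size B' :: parts_of_beta B' else [::].

Lemma parts_of_betaK B : sorted gtn B -> 0 \notin B ->
  is_partition (parts_of_beta B) /\ beta_set (parts_of_beta B) = B.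
Proof.
have tr : transitive gtn by move=> a b c /=; lia.
elim: B => [|b B IH] //; rewrite /= path_sortedE // inE negb_or.
move=> /andP[hb /IH{}IH] /andP[b0 /IH{IH} [hP hB]].
have sz : size (parts_of_beta B) = size B by rewrite -size_beta_set hB.
rewrite is_partition_cons hP andbT beta_set_cons hB sz.
case: B hb hP hB sz => [|c B] /=; first by rewrite subn0 addn0; split=> //; lia.
move=> /andP[cb _]; rewrite is_partition_cons beta_set_cons.
move=> /and3P[c0 hc _] -[Ec _] [sz]; split; last by congr (_ :: _); lia.
apply/and3P; split; [lia|lia|apply: sub_all hc => x /=; lia].
Qed.

(** * Residue counts of a t-core *)

(** Closure under subtracting [t] makes each residue class of the beta-set an initial segment
    [i, i + t, ...], of length [n_res t i la]. *)
Lemma mem_beta_set_n_res t la b : 0 < t -> is_partition la -> is_core t la ->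
  (b \in beta_set la) = (b %/ t < n_res t (b %% t) la).
Proof.
move=> t0 hla /(is_core_sub_closed _ hla) hB.
set i := b %% t; have it : i < t by rewrite ltn_mod.
rewrite {1}(divn_eq b t) -/i addnC; set k := b %/ t.
pose P k := i + k * t \notin beta_set la.
have exP : exists k, P k.
  exists (\max_(x <- beta_set la) x).+1; apply/negP => h.
  have /= := @leq_bigmax_seq _ _ xpredT id _ h isT; nia.
case: (ex_minnP exP) => n nP n_min.
have memE j : (i + j * t \in beta_set la) = (j < n).
  case: (ltnP j n) => jn; first by apply/negPn/negP => /n_min; lia.
  apply: contraNF nP => /(sub_closed_muln (k := j - n) hB).
  have -> : i + j * t - (j - n) * t = i + n * t by nia.
  by apply; nia.
rewrite memE; congr (_ < _).
(* The beta-numbers in class [i] are the [i + j * t] with [j < n], so there are [n] of them. *)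
rewrite /n_res -size_filter -(size_iota 0 n) -(size_map (fun j => i + j * t)).
apply: perm_size; apply: uniq_perm.
- by rewrite map_inj_uniq ?iota_uniq // => x y; nia.
- by rewrite filter_uniq ?beta_set_uniq.
move=> x; rewrite mem_filter; apply/mapP/andP.
  case=> j; rewrite mem_iota add0n /= => jn ->.
  by rewrite memE jn; split=> //; rewrite addnC modnMDl.
case=> /eqP xi xB; exists (x %/ t); last first.
  by rewrite {1}(divn_eq x t) xi modn_mod addnC.
by rewrite mem_iota add0n /= -memE addnC -(modn_small it) -xi -divn_eq.
Qed.

Lemma mem_addn_muln_beta_set t la i k :
  is_partition la -> is_core t la -> i < t ->
  (i + k * t \in beta_set la) = (k < n_res t i la).
Proof.
move=> hla hc it; have t0 : 0 < t by lia.
rewrite (mem_beta_set_n_res _ t0 hla hc) addnC modnMDl divnMDl //.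
by rewrite modn_small // divn_small // addn0.
Qed.

Lemma n_res0 t la : 0 < t -> is_partition la -> is_core t la -> n_res t 0 la = 0.
Proof.
move=> t0 hla hc; have := mem_addn_muln_beta_set 0 hla hc t0.
rewrite (negPf (mem0_beta_set hla)); lia.
Qed.

(** Nonempty classes [i] and [i.+1] contain the adjacent numbers [i] and [i.+1]. Conversely,
    adjacent beta-numbers lie in adjacent classes, a wrap from [t - 1] to 0 being excluded by
    [n_res0]. *)
Lemma core_distinct_parts t la : 0 < t -> is_partition la -> is_core t la ->
  (distinct_parts la <->
   forall i, i.+1 < t -> n_res t i la * n_res t i.+1 la = 0).
Proof.
move=> t0 hla hc; rewrite distinct_parts_beta_set //; split=> h.
  move=> i it; apply/eqP; rewrite muln_eq0 !eqn0Ngt -negb_and; apply/negP.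
  have memE := mem_addn_muln_beta_set 0 hla hc.
  rewrite -!memE ?(ltnW it) // mul0n !addn0 => /andP[/h h1 h2].
  by rewrite h2 in h1.
move=> x xB; apply/negP => xB1.
have it : x %% t < t by rewrite ltn_mod.
have E : x.+1 = x %/ t * t + (x %% t).+1 by rewrite addnS -divn_eq.
move: xB xB1; rewrite !(mem_beta_set_n_res _ t0 hla hc) E modnMDl.
case: (ltnP (x %% t).+1 t) => i1t.
  rewrite [(_).+1 %% t]modn_small // => h1 h2.
  have /eqP := h _ i1t; rewrite muln_eq0 => /orP[] /eqP n0.
    by rewrite n0 in h1.
  by rewrite n0 in h2.
have -> : (x %% t).+1 = t by lia.
by rewrite modnn n_res0.
Qed.

Lemma distinct_core_muln1 m t la : 0 < t ->
  is_partition la -> distinct_parts la -> is_core t la ->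
  (is_core (m * t + 1) la <-> forall i, i < t -> n_res t i la <= m).
Proof.
move=> t0 hla hd hc; rewrite is_core_sub_closed //; split=> h.
  move=> i it; rewrite leqNgt -(mem_addn_muln_beta_set _ hla hc) //.
  apply/negP => hi; case: i it hi => [|i] it hi.
    by move: hi; rewrite (mem_addn_muln_beta_set _ hla hc) // n_res0.
  have := h _ hi; have -> : i.+1 + m * t - (m * t + 1) = i by lia.
  move=> /(_ ltac:(lia)); rewrite -[i]addn0 -(mul0n t).
  rewrite (mem_addn_muln_beta_set _ hla hc) ?(ltnW it) // => hi0.
  move: hi; rewrite (mem_addn_muln_beta_set _ hla hc) // => hi1.
  have /(core_distinct_parts t0 hla hc) /(_ _ it) := hd; nia.
(* With all counts at most [m], every beta-number is below [m * t], so none reaches [m * t + 1]. *)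
move=> b; rewrite (mem_beta_set_n_res _ t0 hla hc) => hb leb.
have it : b %% t < t by rewrite ltn_mod.
by have := h _ it; have := divn_eq b t; nia.
Qed.

(** * Recovering a core from its residue counts *)

Lemma eq_n_res_core t la mu : 0 < t ->
  is_partition la -> is_core t la -> is_partition mu -> is_core t mu ->
  (forall i, 0 < i < t -> n_res t i la = n_res t i mu) -> la = mu.
Proof.
move=> t0 hla cla hmu cmu E; apply: beta_set_inj.
apply: (@irr_sorted_eq _ gtn); rewrite ?sorted_beta_set //.
- by move=> a b c /=; lia.
- by move=> a /=; lia.
move=> b; rewrite !(mem_beta_set_n_res _ t0) //.
have it : b %% t < t by rewrite ltn_mod.
by case: (posnP (b %% t)) => [->|i0]; rewrite ?n_res0 // E ?i0.
Qed.

(** The beta-set is prescribed by [b %/ t < f (b %% t)]; the condition [f 0 = 0] keeps 0 out of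
    it. *)
Lemma ex_core_n_res t (f : nat -> nat) : 0 < t -> f 0 = 0 ->
  exists la, [/\ is_partition la, is_core t la &
                 forall i, i < t -> n_res t i la = f i].
Proof.
(* Every [b] with [b %/ t < f (b %% t)] is below [M], so the cut at [M] loses nothing. *)
move=> t0 f0; pose M := (\max_(i < t) f i) * t.
pose B := [seq b <- rev (iota 0 M) | b %/ t < f (b %% t)].
have memB b : (b \in B) = (b %/ t < f (b %% t)).
  rewrite mem_filter mem_rev mem_iota add0n /=; case: ltnP => //= h.
  have it : b %% t < t by rewrite ltn_mod.
  have := leq_bigmax (F := fun i : 'I_t => f i) (Ordinal it).
  rewrite /M -ltn_divLR //=; lia.
have sB : sorted gtn B.
  apply: sorted_filter; first by move=> a b c /=; lia.
  by rewrite rev_sorted iota_ltn_sorted.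
have [|hla hB] := parts_of_betaK sB; first by rewrite memB mod0n f0.
have hc : is_core t (parts_of_beta B).
  apply/is_core_sub_closed => //; rewrite hB => b; rewrite !memB => hb tb.
  have -> : (b - t) %% t = b %% t by rewrite -{2}(subnK tb) modnDr.
  by apply: leq_ltn_trans hb; apply: leq_div2r; apply: leq_subr.
exists (parts_of_beta B); split=> // i it.
have E k : (k < n_res t i (parts_of_beta B)) = (k < f i).
  rewrite -(mem_addn_muln_beta_set _ hla hc) // hB memB addnC modnMDl divnMDl //.
  by rewrite modn_small // divn_small // addn0.
by have := E (f i); have := E (n_res t i (parts_of_beta B)); lia.
Qed.

(** * Bijectivity of [psi] *)

Lemma nth_psi t la i : i < t.-1 -> nth 0 (psi t la) i = n_res t i.+1 la.
Proof.
move=> it; rewrite -[i]/(val (Ordinal it)) -tnth_nth.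
by rewrite tnth_mktuple.
Qed.

Lemma Splus_core m t la : 0 < t -> is_partition la -> is_core t la ->
  (Splus m t la <-> Cplus m t (psi t la)).
Proof.
move=> t0 hla hc; split.
  case=> _ hd _ hcm; split=> i it.
    rewrite nth_psi //; have /(distinct_core_muln1 m t0 hla hd hc) := hcm.
    by apply; lia.
  rewrite !nth_psi ?(ltnW it) //.
  by have /(core_distinct_parts t0 hla hc) := hd; apply; lia.
case=> hm h0.
have hd : distinct_parts la.
  (* The tuple starts at residue 1; the pair of residues 0 and 1 is settled by [n_res0]. *)
  apply/(core_distinct_parts t0 hla hc) => -[|i] it; first by rewrite n_res0.
  by rewrite -!nth_psi ?h0 //; lia.
split=> //; apply/(distinct_core_muln1 m t0 hla hd hc) => -[|i] it.
  by rewrite n_res0.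
by rewrite -nth_psi ?hm //; lia.
Qed.

Theorem theorem3p1 (t m : nat) (ht : 2 <= t) (hm : 1 <= m) :
  set_bij (Splus m t) (Cplus m t) (psi t).
Proof.
have t0 : 0 < t by lia.
split.
- move=> la hS; have [hla _ hc _] := hS.
  exact/(Splus_core m t0 hla hc).
- move=> la mu; rewrite !inE => -[hla _ cla _] [hmu _ cmu _] E.
  apply: (eq_n_res_core t0 hla cla hmu cmu) => -[|i] //= it.
  by rewrite -!nth_psi ?E //; lia.
move=> x hx.
(* The prescribed counts are 0 in class 0 and the entry of [x] at position [j] in class [j.+1]. *)
have [la [hla hc E]] :=
  @ex_core_n_res t (fun i => if i is j.+1 then nth 0 x j else 0) t0 erefl.
have psiE : psi t la = x.
  apply: val_inj; apply: (@eq_from_nth _ 0); first by rewrite !size_tuple.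
  by move=> i; rewrite size_tuple => it; rewrite nth_psi // E //; lia.
by exists la => //; apply/(Splus_core m t0 hla hc); rewrite psiE.
Qed.
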